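(* Let $\mu$ be a discrete growth rate. If the system $x(k+1)=A(k)x(k)$, $k\in\mathbb{Z}$, with $A:\mathbb{Z}\to\mathbb{R}^{d\times d}$, admits $\mu\mathrm{D}$ or $\mathrm{N}\mu\mathrm{D}$ with invariant projector $n\mapsto\mathrm{P}(n)$, then $\mathrm{im}\,\mathrm{P}=\mathcal{S}$ and $\ker\mathrm{P}=\mathcal{U}$, and thus $\mathcal{S}\oplus\mathcal{U}=\mathbb{Z}\times\mathbb{R}^d$. Moreover, in this case the system has both the USP and the UPP.
   Context: Let $d\ge 1$, $A:\mathbb{Z}\to\mathbb{R}^{d\times d}$ (not assumed nonsingular) and consider the system $x(k+1)=A(k)x(k)$, $k\in\mathbb{Z}$. Evolution operator: $\Phi(k,n)=A(k-1)\cdots A(n)$ for $k>n$, $\Phi(n,n)=\mathrm{Id}$; if $A$ is nonsingular, $\Phi(k,n)=A^{-1}(k)\cdots A^{-1}(n-1)$ for $k<n$. Invariant projector: a map $\mathrm{P}:\mathbb{Z}\to\mathbb{R}^{d\times d}$ of idempotents with $A(n)\mathrm{P}(n)=\mathrm{P}(n+1)A(n)$ and such that $A(n)|_{\ker \mathrm{P}(n)}:\ker \mathrm{P}(n)\to\ker \mathrm{P}(n+1)$ is an isomorphism, for all $n\in\mathbb{Z}$. Given an invariant projector, for $k<n$ one sets $\Phi(k,n)=[\Phi(n,k)|_{\ker \mathrm{P}(k)}]^{-1}:\ker \mathrm{P}(n)\to\ker \mathrm{P}(k)$ (also when $A$ is singular). Put $\mathrm{im}\,\mathrm{P}=\{(n,\xi):\xi\in\mathrm{im}\,\mathrm{P}(n)\}$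 and $\ker\mathrm{P}=\{(n,\xi):\xi\in\ker\mathrm{P}(n)\}$, subsets of $\mathbb{Z}\times\mathbb{R}^d$. Discrete growth rate: a non-decreasing map $\mu:\mathbb{Z}\to(0,\infty)$ with $\mu(0)=1$, $\lim_{n\to+\infty}\mu(n)=+\infty$, $\lim_{n\to-\infty}\mu(n)=0$. Put $\mathrm{sgn}(n)=1,0,-1$ for $n>0$, $n=0$, $n<0$. Dichotomies: the system admits a nonuniform $\mu$-dichotomy ($\mathrm{N}\mu\mathrm{D}$) with invariant projector $\mathrm{P}$ if there are constants $K\ge1$, $\alpha<0$, $\beta>0$, $\theta,\nu\ge0$ with $\alpha+\theta<0$, $\beta-\nu>0$ and $$\|\Phi(k,n)\mathrm{P}(n)\|\le K\left(\tfrac{\mu(k)}{\mu(n)}\right)^{\alpha}\mu(n)^{\mathrm{sgn}(n)\theta}\ (k\ge n),\qquad \|\Phi(k,n)[\mathrm{Id}-\mathrm{P}(n)]\|\le K\left(\tfrac{\mu(k)}{\mu(n)}\right)^{\beta}\mu(n)^{\mathrm{sgn}(n)\nu}\ (k\le n).$$ If $\theta=\nu=0$ it is a uniform $\mu$-dichotomy ($\mu\mathrm{D}$). If the conditions $\alpha+\theta<0$ and $\beta-\nu>0$ are not imposed, it is a slow nonuniform $\mu$-dichotomy ($\mathrm{sN}\mu\mathrm{D}$). (If $\mathrm{P}=\mathrm{Id}$ there are no $\beta,\nu$; if $\mathrm{P}=0$ there are no $\alpha,\theta$.) Stable and unstable manifolds: $\mathcal{S}=\{(n,\xi)\in\mathbb{Z}\times\mathbb{R}^d:\sup_{k\in\mathbb{Z}^+}\|\Phi(k,n)\xi\|<\infty\}$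 and $\mathcal{U}=\{(n,\xi)\in\mathbb{Z}\times\mathbb{R}^d:\sup_{k\in\mathbb{Z}^-}\|\Phi(k,n)\xi\|<\infty\}$. When $A$ is singular, in $\mathcal{S}$ only $k\ge n$ is considered, and $(n,\xi)\in\mathcal{U}$ means that there is a bounded sequence $(x(k))_{k\le n}$ with $x(n)=\xi$ and $x(k+1)=A(k)x(k)$ for $k<n$. Sums and intersections of such sets are taken fiberwise over $n\in\mathbb{Z}$, and $\mathcal{S}\oplus\mathcal{U}$ denotes the (Whitney) sum when $\mathcal{S}\cap\mathcal{U}=\mathbb{Z}\times\{0\}$. USP (unbounded solutions property): the system has no nontrivial solution $x:\mathbb{Z}\to\mathbb{R}^d$ that is bounded. UPP (unique projector property): there is at most one invariant projector for which the system admits a dichotomy (of any of the types $\mu\mathrm{D}$, $\mathrm{N}\mu\mathrm{D}$, $\mathrm{sN}\mu\mathrm{D}$, with the given $\mu$). *)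

(* Defs.v *)
From HB Require Import structures.
From mathcomp Require Import all_boot all_order all_algebra.
From mathcomp Require Import all_classical all_reals all_analysis.
Set Implicit Arguments.
Unset Strict Implicit.
Unset Printing Implicit Defensive.
Import Order.TTheory GRing.Theory Num.Theory.
Import numFieldNormedType.Exports.
Local Open Scope classical_set_scope.
Local Open Scope ring_scope.

Record is_norm (R : realType) (d : nat) (N : 'cV[R]_d -> R) : Prop := IsNorm {
  norm_triangle : forall x y, N (x + y) <= N x + N y ;
  norm_homogeneous : forall a x, N (a *: x) = `|a| * N x ;
  norm_definite : forall x, N x = 0 -> x = 0 }.

(* Induced operator norm.  It takes values in [\bar R] so that it is a genuine
   supremum without a boundedness proof; it is finite on linear maps. *)
Definition opnorm (R : realType) (d : nat) (N : 'cV[R]_d -> R)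
    (f : 'cV[R]_d -> 'cV[R]_d) : \bar R :=
  ereal_sup [set (N (f x))%:E | x in [set x | N x <= 1]].

Definition mx_im (R : realType) (d : nat) (M : 'M[R]_d) : set 'cV[R]_d :=
  range (fun x : 'cV[R]_d => M *m x).

Definition mx_ker (R : realType) (d : nat) (M : 'M[R]_d) : set 'cV[R]_d :=
  [set x | M *m x = 0].

Record discrete_growth_rate (R : realType) (mu : int -> R) : Prop :=
  DiscreteGrowthRate {
    growth_gt0 : forall n, 0 < mu n ;
    growth_nondecreasing : {homo mu : m n / m <= n} ;
    growth_at0 : mu 0 = 1 ;
    growth_pinfty : mu n%:Z @[n --> \oo] --> +oo ;
    growth_ninfty : mu (- n%:Z) @[n --> \oo] --> (0 : R) }.

Section System.
Context (R : realType) (d : nat).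
Implicit Types (A P : int -> 'M[R]_d) (N : 'cV[R]_d -> R) (mu : int -> R).

Definition nonsingular A : Prop := forall k, A k \in unitmx.

(* For [k < n] this is meaningful only when [A] is nonsingular, since [invmx]
   is the identity on noninvertible matrices. *)
Definition Phi A (k n : int) : 'M[R]_d :=
  if n <= k
  then \big[mulmx/1%:M]_(i < `|k - n|%N) A (k - 1 - (i : nat)%:Z)
  else \big[mulmx/1%:M]_(i < `|n - k|%N) invmx (A (k + (i : nat)%:Z)).

Definition invariant_projector A P : Prop :=
  forall n, [/\ P n *m P n = P n,
                A n *m P n = P (n + 1) *m A n &
                set_bij (mx_ker (P n)) (mx_ker (P (n + 1)))
                  (fun x : 'cV[R]_d => A n *m x)].

(* [Phi(k, n) = (Phi(n, k) restricted to ker P(k))^-1 : ker P(n) -> ker P(k)]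
   for [k <= n]; the value outside [ker P(n)] is irrelevant. *)
Definition Phi_ker A P (k n : int) : 'cV[R]_d -> 'cV[R]_d :=
  'pinv_(fun=> 0) (mx_ker (P k)) (fun x : 'cV[R]_d => Phi A n k *m x).

Definition dichotomy_estimates N mu A P (K alpha beta theta nu : R) : Prop :=
  (forall k n : int, n <= k ->
     (opnorm N (fun x => Phi A k n *m (P n *m x)) <=
       (K * (mu k / mu n) `^ alpha * mu n `^ ((sgz n)%:~R * theta))%:E)%E) /\
  (forall k n : int, k <= n ->
     (opnorm N (fun x => Phi_ker A P k n ((1%:M - P n) *m x)) <=
       (K * (mu k / mu n) `^ beta * mu n `^ ((sgz n)%:~R * nu))%:E)%E).

(* In the three definitions below the cases [P = Id] (no [beta], [nu]) and
   [P = 0] (no [alpha], [theta]) need no separate clause: the corresponding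
   estimate then bounds the zero map, and holds for any choice of these
   constants. *)
Definition muD N mu A P : Prop :=
  invariant_projector A P /\
  exists K alpha beta : R,
    [/\ 1 <= K, alpha < 0, 0 < beta &
        dichotomy_estimates N mu A P K alpha beta 0 0].

Definition NmuD N mu A P : Prop :=
  invariant_projector A P /\
  exists K alpha beta theta nu : R,
    [/\ [/\ 1 <= K, alpha < 0, 0 < beta, 0 <= theta & 0 <= nu],
        alpha + theta < 0, 0 < beta - nu &
        dichotomy_estimates N mu A P K alpha beta theta nu].

Definition sNmuD N mu A P : Prop :=
  invariant_projector A P /\
  exists K alpha beta theta nu : R,
    [/\ 1 <= K, alpha < 0, 0 < beta, 0 <= theta & 0 <= nu] /\
    dichotomy_estimates N mu A P K alpha beta theta nu.

Definition im_bundle P : set (int * 'cV[R]_d) :=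
  [set p | mx_im (P p.1) p.2].

Definition ker_bundle P : set (int * 'cV[R]_d) :=
  [set p | mx_ker (P p.1) p.2].

Definition stable_manifold N A : set (int * 'cV[R]_d) :=
  [set p | has_ubound [set N (Phi A k p.1 *m p.2)
             | k in [set k : int | 0 <= k /\ (nonsingular A \/ p.1 <= k)]]].

Definition unstable_manifold N A : set (int * 'cV[R]_d) :=
  [set p |
     (nonsingular A /\
      has_ubound [set N (Phi A k p.1 *m p.2) | k in [set k : int | k <= 0]]) \/
     (~ nonsingular A /\
      exists x : int -> 'cV[R]_d,
        [/\ x p.1 = p.2,
            forall k, k < p.1 -> x (k + 1) = A k *m x k &
            has_ubound [set N (x k) | k in [set k : int | k <= p.1]]])].

Definition fiber_sum (S U : set (int * 'cV[R]_d)) : set (int * 'cV[R]_d) :=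
  [set p | exists x y, [/\ S (p.1, x), U (p.1, y) & p.2 = x + y]].

(* [S (+) U = W] : the sum is [W] and is direct in every fiber. *)
Definition whitney_sum_eq (S U W : set (int * 'cV[R]_d)) : Prop :=
  S `&` U = [set p | p.2 = 0] /\ fiber_sum S U = W.

Definition USP N A : Prop :=
  forall x : int -> 'cV[R]_d,
    (forall k, x (k + 1) = A k *m x k) ->
    has_ubound (range (fun k => N (x k))) -> forall k, x k = 0.

Definition admits_dichotomy N mu A P : Prop :=
  [\/ muD N mu A P, NmuD N mu A P | sNmuD N mu A P].

Definition UPP N mu A : Prop :=
  forall P Q, admits_dichotomy N mu A P -> admits_dichotomy N mu A Q -> P = Q.

End System.

(* Main.v *)
(* A forward bounded orbit starting at xi in fiber n has an unstable component
   that is recovered from the orbit at time k by Phi(n, k), so it is at most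
   const * mu(k)^(nu - beta), which tends to 0 as k -> +oo; hence S is contained
   in im P.  Symmetrically, the stable component of a backward bounded orbit is
   at most const * mu(k)^(-(alpha + theta)), which tends to 0 as k -> -oo, so U
   is contained in ker P.  The converse inclusions hold even for a slow
   dichotomy, since they only need mu(k)/mu(n) to stay on one side of 1;
   therefore any projector Q of a slow dichotomy satisfies im Q <= S = im P and
   ker Q <= U = ker P, which forces Q = P. *)
Require Import Defs.
From mathcomp Require Import all_boot all_order all_algebra.
From mathcomp Require Import all_classical all_reals all_analysis.
From mathcomp Require Import zify lra.
Set Implicit Arguments.
Unset Strict Implicit.
Unset Printing Implicit Defensive.
Import Order.TTheory GRing.Theory Num.Theory.
Local Open Scope classical_set_scope.
Local Open Scope ring_scope.

(** * Induction on integers and elementary facts on matrices and powers *)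

Lemma int_up_ind (Q : int -> Prop) (n : int) :
  Q n -> (forall k : int, n <= k -> Q k -> Q (k + 1)) -> forall k : int, n <= k -> Q k.
Proof.
move=> Qn QS k nk; have -> : k = n + `|k - n|%N%:Z by lia.
elim: `|k - n|%N => [|m IH]; first by rewrite addr0.
have -> : n + m.+1%:Z = n + m%:Z + 1 by lia.
by apply: QS => //; lia.
Qed.

Lemma int_down_ind (Q : int -> Prop) (n : int) :
  Q n -> (forall k : int, k < n -> Q (k + 1) -> Q k) -> forall k : int, k <= n -> Q k.
Proof.
move=> Qn QP k kn; have -> : k = n - `|n - k|%N%:Z by lia.
elim: `|n - k|%N => [|m IH]; first by rewrite subr0.
apply: QP; first by lia.
by have -> : n - m.+1%:Z + 1 = n - m%:Z by lia.
Qed.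

(** Serves to fill the finite gap between time [0], where the manifolds start, and time [n], where
    the dichotomy estimates start. *)
Lemma int_window_bounded (R : realType) (f : int -> R) (a b : int) :
  exists C, forall k : int, a <= k <= b -> f k <= C.
Proof.
have [ab|ba] := leP a b; last by exists 0 => k /andP[? ?]; lia.
move: b ab; apply: int_up_ind.
  by exists (f a) => k ak; have -> : k = a by lia.
move=> b ab [C hC]; exists (Num.max C (f (b + 1))) => k /andP[ak kb].
rewrite le_max; have [kb'|kb'] := leP k b; first by rewrite hC ?ak.
have -> : k = b + 1 by lia.
by rewrite lexx orbT.
Qed.

Lemma mulmx_cV_inj (R : nzRingType) (m n : nat) (M M' : 'M[R]_(m, n)) :
  (forall x : 'cV[R]_n, M *m x = M' *m x) -> M = M'.
Proof.
move=> MM'; apply/matrixP => i j.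
by have := MM' (delta_mx j 0); rewrite -!colE => /colP/(_ i); rewrite !mxE.
Qed.

Lemma powR_div (R : realType) (x y r : R) :
  0 < x -> 0 < y -> (x / y) `^ r = x `^ r * y `^ (- r).
Proof.
move=> x0 y0; rewrite powRM ?invr_ge0 ?ltW//.
by rewrite -powR_inv1 ?ltW// -powRrM mulN1r.
Qed.

(** * Comparison arguments driven by the limits of the growth rate *)

Section GrowthRate.
Context (R : realType) (mu : int -> R) (mu_growth : discrete_growth_rate mu).

Lemma growth_large (M : R) (k0 : int) : exists2 k : int, k0 <= k & M < mu k.
Proof.
have /cvgryPgt/(_ M)[m _ hm] := growth_pinfty mu_growth.
exists (maxn m `|k0|%N)%:Z; first by lia.
by apply: hm => /=; lia.
Qed.

Lemma growth_small (e : R) (k0 : int) : 0 < e -> exists2 k : int, k <= k0 & mu k < e.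
Proof.
move=> e0; have /cvgr_lt/(_ e e0)[m _ hm] := growth_ninfty mu_growth.
exists (- (maxn m `|k0|%N)%:Z); first by lia.
by apply: hm => /=; lia.
Qed.

(** If [a > 0], any [k] with [mu k] beyond the [e]-th root of [D / a] violates the bound. *)
Lemma le0_of_growth (a D e : R) (k0 : int) : 0 < e ->
  (forall k : int, k0 <= k -> a * mu k `^ e <= D) -> a <= 0.
Proof.
move=> e0 h; rewrite leNgt; apply/negP => a0.
have [k kk0 hk] := growth_large ((D / a) `^ e^-1) k0.
have D0 : 0 <= D / a.
  apply: divr_ge0 (ltW a0); apply: le_trans (h _ kk0).
  by rewrite mulr_ge0 ?powR_ge0 ?ltW.
have mk := growth_gt0 mu_growth k.
have := gt0_ltr_powR e0 _ _ hk.
rewrite !nnegrE powR_ge0 ltW// -powRrM mulVf ?gt_eqF// powRr1//.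
move=> /(_ isT isT); rewrite ltr_pdivrMr// mulrC => /lt_le_trans/(_ (h _ kk0)).
by rewrite ltxx.
Qed.

(** For [D <= 0] a single index decides. Otherwise a positive [a] is refuted by any [k] with [mu k]
    below the [e]-th root of [a / D]. *)
Lemma le0_of_decay (a D e : R) (k0 : int) : 0 < e ->
  (forall k : int, k <= k0 -> a <= D * mu k `^ e) -> a <= 0.
Proof.
move=> e0 h; have [D0|D0] := leP D 0.
  by apply: le_trans (h _ (lexx _)) _; rewrite mulr_le0_ge0 ?powR_ge0.
rewrite leNgt; apply/negP => a0.
have aD : 0 < a / D by rewrite divr_gt0.
have [k kk0 hk] := growth_small k0 (powR_gt0 e^-1 aD).
have mk := growth_gt0 mu_growth k.
have := gt0_ltr_powR e0 _ _ hk.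
rewrite !nnegrE powR_ge0 ltW// -powRrM mulVf ?gt_eqF// powRr1 ?ltW//.
move=> /(_ isT isT); rewrite ltr_pdivlMr// mulrC.
by move=> /(le_lt_trans (h _ kk0)); rewrite ltxx.
Qed.

End GrowthRate.

(** * Vector bounds from the operator norm *)

Section Norm.
Context (R : realType) (d : nat) (N : 'cV[R]_d -> R) (N_norm : is_norm N).

Lemma is_norm0 : N 0 = 0.
Proof. by have := norm_homogeneous N_norm 0 0; rewrite scale0r normr0 mul0r. Qed.

Lemma is_norm_ge0 x : 0 <= N x.
Proof.
have := norm_triangle N_norm x (- x); rewrite subrr is_norm0 -scaleN1r.
rewrite (norm_homogeneous N_norm) normrN1 mul1r; lra.
Qed.

Lemma is_norm_le0 x : N x <= 0 -> x = 0.
Proof.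
move=> Nx; apply: (norm_definite N_norm).
by apply/eqP; rewrite eq_le Nx is_norm_ge0.
Qed.

(** Rescaling [x] to norm one uses homogeneity alone, which is easy to obtain for the set-theoretic
    inverse [Phi_ker]. *)
Lemma le_opnorm (f : 'cV[R]_d -> 'cV[R]_d) (c : R) (x : 'cV[R]_d) :
  (forall a, f (a *: x) = a *: f x) -> (opnorm N f <= c%:E)%E ->
  N (f x) <= c * N x.
Proof.
move=> fZ fc; have [x0|x0] := eqVneq x 0.
  by have := fZ 0; rewrite x0 !scale0r => ->; rewrite is_norm0 mulr0 lexx.
have Nx : 0 < N x.
  rewrite lt_neqAle is_norm_ge0 andbT eq_sym.
  by apply: contra_neq x0 => /(norm_definite N_norm).
rewrite -ler_pdivrMr// -lee_fin; apply: le_trans fc.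
apply: ereal_sup_ubound; exists ((N x)^-1 *: x) => /=.
  by rewrite (norm_homogeneous N_norm) ger0_norm ?invr_ge0 ?is_norm_ge0// mulVf ?gt_eqF.
rewrite fZ (norm_homogeneous N_norm) ger0_norm ?invr_ge0 ?is_norm_ge0//.
by rewrite mulrC.
Qed.

End Norm.

(** * Cocycle rules for the evolution operator *)

Section Evolution.
Context (R : realType) (d : nat) (A : int -> 'M[R]_d).

Lemma Phi_id (n : int) : Phi A n n = 1%:M.
Proof. by rewrite /Phi lexx subrr big_ord0. Qed.

Lemma PhiSl (k n : int) : n <= k -> Phi A (k + 1) n = A k *m Phi A k n.
Proof.
move=> nk; rewrite /Phi nk (_ : n <= k + 1); last by lia.
have -> : `|(k + 1)%R - n|%N = (`|k - n|%N).+1 by lia.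
rewrite big_ord_recl subr0 addrK; congr (_ *m _).
by apply: eq_bigr => i _; congr (A _); rewrite /= /bump /=; lia.
Qed.

Lemma Phi_pred_nonsingular (k n : int) : k < n -> Phi A k n = invmx (A k) *m Phi A (k + 1) n.
Proof.
(* For [k + 1 = n] the factor [Phi A (k + 1) n] falls in the forward branch of [Phi], so this case
   is computed apart. *)
move=> kn; have [<-|kn1] := eqVneq (k + 1) n.
  rewrite Phi_id mulmx1 /Phi ifF; last by lia.
  have -> : `|(k + 1)%R - k|%N = 1%N by lia.
  by rewrite big_ord_recl big_ord0 mulmx1 addr0.
rewrite /Phi !ifF; [|by lia..].
have -> : `|n - k|%N = (`|n - (k + 1)%R|%N).+1 by lia.
rewrite big_ord_recl addr0; congr (_ *m _).
by apply: eq_bigr => i _; congr (invmx (A _)); rewrite /= /bump /=; lia.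
Qed.

Lemma PhiS_nonsingular : nonsingular A ->
  forall k n : int, Phi A (k + 1) n = A k *m Phi A k n.
Proof.
move=> Ans k n; have [/PhiSl//|kn] := leP n k.
by rewrite (Phi_pred_nonsingular kn) mulmxA mulmxV ?mul1mx.
Qed.

Lemma PhiSr (k n : int) : n < k -> Phi A k n = Phi A k (n + 1) *m A n.
Proof.
move=> nk; have {nk} : n + 1 <= k by lia.
move: k; apply: int_up_ind; first by rewrite Phi_id mul1mx PhiSl// Phi_id mulmx1.
by move=> k nk IH; rewrite !PhiSl ?IH ?mulmxA//; lia.
Qed.

(** The recursion is asked only between [n] and [k], so that solutions on a half-line qualify,
    forward or backward. *)
Lemma Phi_solution (x : int -> 'cV[R]_d) (n k : int) : n <= k ->
  (forall i : int, n <= i < k -> x (i + 1) = A i *m x i) -> x k = Phi A k n *m x n.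
Proof.
move: k; apply: int_up_ind; first by rewrite Phi_id mul1mx.
move=> k nk IH h; rewrite h; last by lia.
rewrite PhiSl// -mulmxA IH// => i ik; apply: h; lia.
Qed.

(** * Evolution along the image and the kernel of an invariant projector *)

Context (P : int -> 'M[R]_d) (P_inv : invariant_projector A P).

Lemma projK (n : int) (x : 'cV[R]_d) : P n *m (P n *m x) = P n *m x.
Proof. by have [idP _ _] := P_inv n; rewrite mulmxA idP. Qed.

Lemma ker_compl (n : int) (x : 'cV[R]_d) : P n *m (x - P n *m x) = 0.
Proof. by rewrite mulmxBr projK subrr. Qed.

Lemma im_projP (n : int) (x : 'cV[R]_d) : mx_im (P n) x <-> P n *m x = x.
Proof.
by split=> [[y _ <-]|<-]; [rewrite projK|exists x].
Qed.

Lemma Phi_proj (k n : int) (x : 'cV[R]_d) : n <= k ->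
  P k *m (Phi A k n *m x) = Phi A k n *m (P n *m x).
Proof.
move: k; apply: int_up_ind; first by rewrite Phi_id !mul1mx.
move=> k nk IH; rewrite !PhiSl// -!mulmxA -IH !mulmxA.
by have [_ -> _] := P_inv k.
Qed.

(** Composes the one-step bijections between kernels; this is what makes the pseudo-inverse
    [Phi_ker] a true inverse there. *)
Lemma Phi_ker_bij (k n : int) : n <= k ->
  set_bij (mx_ker (P n)) (mx_ker (P k)) (fun x => Phi A k n *m x).
Proof.
move: k; apply: int_up_ind.
  rewrite Phi_id; split=> [x /=|x y _ _|x xK]; rewrite ?mul1mx//.
  by exists x => //; rewrite mul1mx.
move=> k nk [f_fun f_inj f_surj]; have [_ _ [g_fun g_inj g_surj]] := P_inv k.
split=> [x xK|x y xK yK|z zK].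
- by rewrite PhiSl// -mulmxA; apply/g_fun/f_fun.
- rewrite PhiSl// -!mulmxA => xy; apply: f_inj => //.
  by apply: g_inj => //; rewrite inE; apply: f_fun; apply/set_mem.
- have [y yK <-] := g_surj _ zK; have [x xK <-] := f_surj _ yK.
  by exists x => //; rewrite PhiSl// -mulmxA.
Qed.

Lemma Phi_kerK (k n : int) (w : 'cV[R]_d) : k <= n -> P k *m w = 0 ->
  Phi_ker A P k n (Phi A n k *m w) = w.
Proof.
move=> kn wK; have [_ f_inj _] := Phi_ker_bij kn.
by rewrite /Phi_ker pinvKV ?inE.
Qed.

Lemma Phi_kerP (k n : int) (z : 'cV[R]_d) : k <= n -> P n *m z = 0 ->
  P k *m Phi_ker A P k n z = 0 /\ Phi A n k *m Phi_ker A P k n z = z.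
Proof.
move=> kn zK; have [_ _ f_surj] := Phi_ker_bij kn.
by have [w wK <-] := f_surj _ zK; rewrite Phi_kerK.
Qed.

Lemma Phi_kerZ (k n : int) (a : R) (z : 'cV[R]_d) : k <= n -> P n *m z = 0 ->
  Phi_ker A P k n (a *: z) = a *: Phi_ker A P k n z.
Proof.
move=> kn zK; have [wK wz] := Phi_kerP kn zK.
by rewrite -{1}wz scalemxAr Phi_kerK// -scalemxAr wK scaler0.
Qed.

(** With [w] the preimage of [z] at time [k], the vector [A k *m w] is a preimage at time [k + 1]
    lying in the kernel, hence the only one. Thus [Phi_ker] produces backward solutions even for
    singular [A]. *)
Lemma Phi_kerS (k n : int) (z : 'cV[R]_d) : k < n -> P n *m z = 0 ->
  Phi_ker A P (k + 1) n z = A k *m Phi_ker A P k n z.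
Proof.
move=> kn zK; have [wK wz] := Phi_kerP (ltW kn) zK.
rewrite -{1}wz PhiSr// -mulmxA Phi_kerK//; first by lia.
by have [_ _ [g_fun _ _]] := P_inv k; apply: g_fun.
Qed.

End Evolution.

(** * Dichotomy estimates and bounded half-orbits *)

Section Dichotomy.
Context (R : realType) (d : nat) (N : 'cV[R]_d -> R) (N_norm : is_norm N).
Context (A : int -> 'M[R]_d) (mu : int -> R) (mu_growth : discrete_growth_rate mu).

Lemma muD_NmuD P : muD N mu A P -> NmuD N mu A P.
Proof.
move=> [P_inv [K [al [be [K1 al0 be0 est]]]]]; split=> //.
by exists K, al, be, 0, 0; split; rewrite ?addr0 ?subr0.
Qed.

Lemma admits_sNmuD P : admits_dichotomy N mu A P -> sNmuD N mu A P.
Proof.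
have NS : NmuD N mu A P -> sNmuD N mu A P.
  move=> [P_inv [K [al [be [th [nu [h _ _ est]]]]]]]; split=> //.
  by exists K, al, be, th, nu.
by case=> [/muD_NmuD/NS|/NS|].
Qed.

Section Estimates.
Context (P : int -> 'M[R]_d) (P_inv : invariant_projector A P).
Context (K al be th nu : R).
Context (est : dichotomy_estimates N mu A P K al be th nu).

Lemma stable_estimate (k n : int) (x : 'cV[R]_d) : n <= k ->
  N (Phi A k n *m (P n *m x)) <=
  K * (mu k / mu n) `^ al * mu n `^ ((sgz n)%:~R * th) * N x.
Proof.
move=> nk; apply: (le_opnorm N_norm) (est.1 k n nk) => a.
by rewrite -!scalemxAr.
Qed.

Lemma unstable_estimate (k n : int) (x : 'cV[R]_d) : k <= n ->
  N (Phi_ker A P k n (x - P n *m x)) <=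
  K * (mu k / mu n) `^ be * mu n `^ ((sgz n)%:~R * nu) * N x.
Proof.
move=> kn; have := est.2 k n kn => /(le_opnorm N_norm).
move=> /(_ x); rewrite mulmxBl mul1mx; apply => a.
by rewrite -scalemxAr mulmxBl mul1mx Phi_kerZ ?(ker_compl P_inv).
Qed.

End Estimates.

(** Asking for the bound only at [k >= 0] lets the lemma apply to [stable_manifold] in the singular
    and nonsingular cases, and to bounded full solutions. *)
Lemma NmuD_forward_bounded P (y : int -> 'cV[R]_d) (n : int) (C : R) : NmuD N mu A P ->
  (forall k : int, n <= k -> y (k + 1) = A k *m y k) ->
  (forall k : int, 0 <= k -> n <= k -> N (y k) <= C) -> P n *m y n = y n.
Proof.
move=> [P_inv [K [al [be [th [nu [[K1 _ _ _ _] _ benu est]]]]]]] y_sol yC.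
apply/eqP; rewrite eq_sym -subr_eq0; apply/eqP/(is_norm_le0 N_norm).
(* From [k >= 1] on, [sgz k = 1], so the nonuniform factor at [k] is the power [nu] of [mu k];
   multiplying by the power [be - nu] cancels all dependence on [mu k] and leaves [D]. *)
apply: (le0_of_growth mu_growth (D := K * mu n `^ be * C) (k0 := Num.max 1 n) benu) => k.
rewrite ge_max => /andP[k1 nk].
have mk := growth_gt0 mu_growth k; have mn := growth_gt0 mu_growth n.
have yk : y k = Phi A k n *m y n by apply: Phi_solution => // i ?; apply: y_sol; lia.
have -> : y n - P n *m y n = Phi_ker A P n k (y k - P k *m y k).
  by rewrite yk Phi_proj// -mulmxBr Phi_kerK// (ker_compl P_inv).
have pk : mu k `^ (- be) * mu k `^ nu * mu k `^ (be - nu) = 1.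
  rewrite -!powRD ?(lt0r_neq0 mk) ?implybT//.
  by rewrite (_ : _ + _ = 0) ?powRr0//; lra.
have := unstable_estimate P_inv est (y k) nk.
rewrite gtr0_sgz ?mul1r; last by lia.
rewrite powR_div// => /(ler_wpM2r (powR_ge0 (mu k) (be - nu)))/le_trans; apply.
move: pk; set b := mu k `^ (- be); set c := mu k `^ nu; set e := mu k `^ _ => pk.
have -> : K * (mu n `^ be * b) * c * N (y k) * e =
  (b * c * e) * (K * mu n `^ be * N (y k)) by lra.
rewrite pk mul1r ler_wpM2l ?yC//; last by lia.
by rewrite mulr_ge0 ?powR_ge0//; lra.
Qed.

Lemma NmuD_backward_bounded P (x : int -> 'cV[R]_d) (n : int) (C : R) : NmuD N mu A P ->
  (forall k : int, k < n -> x (k + 1) = A k *m x k) ->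
  (forall k : int, k <= 0 -> k <= n -> N (x k) <= C) -> P n *m x n = 0.
Proof.
move=> [P_inv [K [al [be [th [nu [[K1 _ _ _ _] alth _ est]]]]]]] x_sol xC.
have e0 : 0 < - (al + th) by lra.
apply/(is_norm_le0 N_norm).
(* For [k <= -1] the sign is [-1], so the nonuniform factor is the power [- th] of [mu k]; together
   with the power [- al] from the ratio it gives the exponent [- (al + th)]. *)
apply: (le0_of_decay mu_growth (D := K * mu n `^ al * C) (k0 := Num.min (-1) n) e0) => k.
rewrite le_min => /andP[k1 kn].
have mk := growth_gt0 mu_growth k; have mn := growth_gt0 mu_growth n.
have xn : x n = Phi A n k *m x k by apply: Phi_solution => // i ?; apply: x_sol; lia.
rewrite xn Phi_proj//.
apply: le_trans (stable_estimate est (x k) kn) _.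
rewrite ltr0_sgz; last by lia.
rewrite powR_div// mulrN1z mulN1r opprD powRD ?(lt0r_neq0 mk) ?implybT//.
set a := mu n `^ al; set b := mu k `^ (- al); set c := mu k `^ (- th).
have -> : K * (a * b) * c * N (x k) = K * a * (b * c) * N (x k) by lra.
have -> : K * a * C * (b * c) = K * a * (b * c) * C by lra.
rewrite ler_wpM2l ?xC//; last by lia.
by rewrite !mulr_ge0 ?powR_ge0//; lra.
Qed.

(** The nonuniform factor sits at the fixed time [n] and is a constant; a ratio at least one raised
    to [al < 0] is at most one. *)
Lemma sNmuD_im_bounded P (n : int) (x : 'cV[R]_d) : sNmuD N mu A P -> P n *m x = x ->
  exists C, forall k : int, n <= k -> N (Phi A k n *m x) <= C.
Proof.
move=> [P_inv [K [al [be [th [nu [[K1 al0 _ _ _] est]]]]]]] Px.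
exists (K * mu n `^ ((sgz n)%:~R * th) * N x) => k nk.
rewrite -{1}Px; apply: le_trans (stable_estimate est x nk) _.
rewrite ler_wpM2r ?is_norm_ge0// ler_wpM2r ?powR_ge0// ler_piMr//; first by lra.
have mun : 1 <= mu k / mu n.
  rewrite ler_pdivlMr ?mul1r ?(growth_gt0 mu_growth)//.
  by rewrite (growth_nondecreasing mu_growth).
by rewrite -(powRr0 (mu k / mu n)); apply: ler_powR mun _ _ (ltW al0).
Qed.

Lemma sNmuD_ker_bounded P (n : int) (z : 'cV[R]_d) : sNmuD N mu A P -> P n *m z = 0 ->
  exists x : int -> 'cV[R]_d, [/\ x n = z,
    forall k : int, k < n -> x (k + 1) = A k *m x k &
    exists C, forall k : int, k <= n -> N (x k) <= C].
Proof.
move=> [P_inv [K [al [be [th [nu [[K1 _ be0 _ _] est]]]]]]] Pz.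
(* The backward orbit inside the kernels is the bounded one; for singular [A] other backward orbits
   through [z] may exist. *)
exists (fun k => Phi_ker A P k n z); split.
- by have [_] := Phi_kerP P_inv (lexx n) Pz; rewrite Phi_id mul1mx.
- by move=> k kn; apply: Phi_kerS.
exists (K * mu n `^ ((sgz n)%:~R * nu) * N z) => k kn.
have := unstable_estimate P_inv est z kn.
rewrite Pz subr0 => /le_trans; apply.
rewrite ler_wpM2r ?is_norm_ge0// ler_wpM2r ?powR_ge0// ler_piMr//; first by lra.
have mk := growth_gt0 mu_growth k; have mn := growth_gt0 mu_growth n.
have mun : 0 < mu k / mu n <= 1.
  by rewrite divr_gt0//= ler_pdivrMr ?mul1r// (growth_nondecreasing mu_growth).
by rewrite -(powRr0 (mu k / mu n)); apply: ger_powR mun _ _ (ltW be0).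
Qed.

(** The inclusion of images gives [P Q = Q] and that of kernels gives [P (Id - Q) = 0], whence
    [P = P Q = Q]. *)
Lemma NmuD_sNmuD_eq P Q : NmuD N mu A P -> sNmuD N mu A Q -> Q = P.
Proof.
move=> Pd Qd; have Q_inv := Qd.1.
apply/funext => n; apply: mulmx_cV_inj => z.
have PQ : P n *m (Q n *m z) = Q n *m z.
  have [C hC] := sNmuD_im_bounded Qd (projK Q_inv n z).
  have := @NmuD_forward_bounded P (fun k => Phi A k n *m (Q n *m z)) n C Pd.
  rewrite Phi_id mul1mx; apply=> [k nk|k _]; last exact: hC.
  by rewrite PhiSl ?mulmxA.
have [x [xn x_sol [C hC]]] := sNmuD_ker_bounded Qd (ker_compl Q_inv n z).
have := NmuD_backward_bounded Pd x_sol (fun k _ => hC k).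
by rewrite xn mulmxBr PQ => /eqP; rewrite subr_eq0 => /eqP ->.
Qed.

(** * Identification of the bundles with the manifolds, and bounded solutions *)

Lemma NmuD_im_bundle P : NmuD N mu A P -> im_bundle P = stable_manifold N A.
Proof.
move=> Pd; have P_inv := Pd.1; have Ps := admits_sNmuD (Or32 _ _ Pd).
apply/seteqP; split=> -[n z]; rewrite /im_bundle /stable_manifold /= (im_projP P_inv).
  move=> Pz; have [C hC] := sNmuD_im_bounded Ps Pz.
  (* For nonsingular [A] the manifold also tests times [0 <= k < n], before the range of the
     estimate. *)
  have [D hD] := int_window_bounded (fun k => N (Phi A k n *m z)) 0 n.
  exists (Num.max C D) => _ /= [k [k0 _] <-]; rewrite le_max.
  by have [nk|kn] := leP n k; [rewrite hC|rewrite hD ?orbT ?k0 ?ltW].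
move=> [C hC].
have := @NmuD_forward_bounded P (fun k => Phi A k n *m z) n C Pd.
rewrite Phi_id mul1mx; apply=> [k nk|k k0 nk].
  by rewrite PhiSl ?mulmxA.
by apply: hC => /=; exists k => //; split=> //; right.
Qed.

Lemma NmuD_ker_bundle P : NmuD N mu A P -> ker_bundle P = unstable_manifold N A.
Proof.
move=> Pd; have P_inv := Pd.1; have Ps := admits_sNmuD (Or32 _ _ Pd).
apply/seteqP; split=> -[n z] /=.
  move=> Pz; have [x [xn x_sol [C hC]]] := sNmuD_ker_bounded Ps Pz.
  have [Ans|Ans] := pselect (nonsingular A); last first.
    by right; split=> //; exists x; split=> //; exists C => _ [k /= kn <-]; apply: hC.
  left; split=> //.
  have [D hD] := int_window_bounded (fun k => N (Phi A k n *m z)) n 0.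
  exists (Num.max C D) => _ /= [k k0 <-]; rewrite le_max.
  have [nk|kn] := ltP n k; first by rewrite hD ?orbT ?k0 ?ltW.
  (* With invertible coefficients the backward solution through [z] is unique, so the bounded orbit
     [x] is the one given by [Phi]. *)
  suff -> : Phi A k n *m z = x k by rewrite hC.
  move: k kn {k0}; apply: int_down_ind; first by rewrite Phi_id mul1mx.
  move=> k kn IH; rewrite Phi_pred_nonsingular// -mulmxA IH x_sol//.
  by rewrite mulmxA mulVmx ?mul1mx.
move=> [[Ans [C hC]]|[_ [x [xn x_sol [C hC]]]]]; last first.
  rewrite /= in xn; rewrite /ker_bundle /mx_ker /= -xn.
  by apply: (NmuD_backward_bounded (C := C) Pd) => // k _ kn; apply: hC => /=; exists k.
have := @NmuD_backward_bounded P (fun k => Phi A k n *m z) n C Pd.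
rewrite Phi_id mul1mx; apply=> [k nk|k k0 nk].
  by rewrite PhiS_nonsingular// mulmxA.
by apply: hC => /=; exists k.
Qed.

(** Boundedness in both directions makes [x n] both fixed and annihilated by [P n]. *)
Lemma NmuD_USP P : NmuD N mu A P -> USP N A.
Proof.
move=> Pd x x_sol [C hC] n.
have NC k : N (x k) <= C by apply: hC; exists k.
rewrite -(NmuD_forward_bounded (y := x) Pd (fun k _ => x_sol k)
  (fun k _ _ => NC k)).
exact: NmuD_backward_bounded Pd (fun k _ => x_sol k) (fun k _ _ => NC k).
Qed.

End Dichotomy.

Lemma whitney_sum_projector (R : realType) (d : nat) (A P : int -> 'M[R]_d) :
  invariant_projector A P -> whitney_sum_eq (im_bundle P) (ker_bundle P) setT.
Proof.
move=> P_inv; split.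
  apply/seteqP; split=> -[n z] /=.
    move=> [] /(im_projP P_inv) /= <-.
    by rewrite /ker_bundle /mx_ker /= (projK P_inv).
  move=> ->; split; rewrite /ker_bundle /mx_ker /= ?mulmx0//.
  by apply/(im_projP P_inv); rewrite /= mulmx0.
apply/seteqP; split=> // -[n z] _.
exists (P n *m z), (z - P n *m z); split => /=; first by exists z.
  exact: (ker_compl P_inv).
by rewrite addrC subrK.
Qed.

Unset Implicit Arguments.

Theorem lemma2p9 (R : realType) (d : nat) (d_ge1 : (1 <= d)%N)
    (N : 'cV[R]_d -> R) (N_norm : is_norm N)
    (A : int -> 'M[R]_d) (mu : int -> R) (mu_growth : discrete_growth_rate mu)
    (P : int -> 'M[R]_d) (P_dich : muD N mu A P \/ NmuD N mu A P) :
  [/\ im_bundle P = stable_manifold N A,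
      ker_bundle P = unstable_manifold N A,
      whitney_sum_eq (stable_manifold N A) (unstable_manifold N A) setT,
      USP N A &
      UPP N mu A].
Proof.
have Pd : NmuD N mu A P by case: P_dich => // /muD_NmuD.
have imP := NmuD_im_bundle N_norm mu_growth Pd.
have kerP := NmuD_ker_bundle N_norm mu_growth Pd.
split=> //.
- by rewrite -imP -kerP; apply: (whitney_sum_projector Pd.1).
- exact: (NmuD_USP N_norm mu_growth Pd).
(* Two competing projectors, possibly both slow, are each compared with the given [P]. *)
have eqP Q := NmuD_sNmuD_eq N_norm mu_growth Pd (Q := Q).
by move=> Q Q' /admits_sNmuD/eqP -> /admits_sNmuD/eqP ->.
Qed.
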